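(* Let $R$ be a commutative ring with unit $1\neq 0$, and let $E$ be a row-finite graph. The Leavitt path algebra $L_R(E)$ is basically simple if and only if $E$ satisfies both of the following conditions: (i) the only saturated hereditary subsets of $E^0$ are $\emptyset$ and $E^0$, and (ii) the graph $E$ satisfies Condition (L).
   Context: Graphs: a graph is a directed graph $E=(E^0,E^1,r,s)$ with countable sets $E^0$ (vertices), $E^1$ (edges) and maps $r,s:E^1\to E^0$ (range, source). It is row-finite if $s^{-1}(v)$ is finite for every $v\in E^0$. A vertex $v$ is regular, $v\in E^0_{\mathrm{reg}}$, if $0<|s^{-1}(v)|<\infty$. A path of length $n\ge 1$ is $\alpha=e_1\cdots e_n$ with $e_i\in E^1$ and $r(e_i)=s(e_{i+1})$; put $s(\alpha)=s(e_1)$, $r(\alpha)=r(e_n)$. Vertices are paths of length $0$. $E^*$ is the set of all finite paths. A cycle is a path $\alpha\in E^*\setminus E^0$ with $s(\alpha)=r(\alpha)$. An exit for $\alpha=e_1\cdots e_n$ is an edge $f\in E^1$ such that, for some $1\le i\le n$, $s(f)=s(e_i)$ but $f\ne e_i$. $E$ satisfies Condition (L) if every cycle in $E$ has an exit. A subset $H\subseteq E^0$ is hereditary if $e\in E^1$ and $s(e)\in H$ imply $r(e)\in H$. A hereditary $H$ is saturated if $v\in E^0_{\mathrm{reg}}$ and $r(s^{-1}(v))\subseteq H$ imply $v\in H$. Rings are not assumed commutative or unital. For $R$ a commutative ring with unit $1$, an $R$-algebra is a ring $A$ that is also a left $R$-module with $\lambda(xy)=(\lambda x)y=x(\lambda y)$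 and $1\cdot x=x$; homomorphisms of $R$-algebras are $R$-linear ring homomorphisms. A Leavitt $E$-family in a ring is a collection $\{v,e,e^*:v\in E^0,e\in E^1\}$ of elements such that the $v$'s are pairwise orthogonal idempotents and: (1) $s(e)e=er(e)=e$; (2) $r(e)e^*=e^*s(e)=e^*$; (3) $e^*f=\delta_{e,f}\,r(e)$ for all $e,f\in E^1$; (4) $v=\sum_{s(e)=v}ee^*$ for every $v\in E^0_{\mathrm{reg}}$. The Leavitt path algebra $L_R(E)$ is the universal $R$-algebra generated by a Leavitt $E$-family $\{v,e,e^*\}$: every Leavitt $E$-family $\{a_v,b_e,c_{e^*}\}$ in an $R$-algebra $A$ is the image of the generators under an $R$-algebra homomorphism $L_R(E)\to A$ with $v\mapsto a_v$, $e\mapsto b_e$, $e^*\mapsto c_{e^*}$. A two-sided ideal $I$ of $L_R(E)$ is basic if whenever $\lambda\in R\setminus\{0\}$, $v\in E^0$ and $\lambda v\in I$, then $v\in I$. $L_R(E)$ is basically simple if its only basic ideals are $\{0\}$ and $L_R(E)$. *)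

(* Defs.v *)
From HB Require Import structures.
From mathcomp Require Import all_boot all_algebra.
From mathcomp Require Import boolp classical_sets functions cardinality fsbigop.

Set Implicit Arguments.
Unset Strict Implicit.
Unset Printing Implicit Defensive.

Import GRing.Theory.

Local Open Scope classical_set_scope.
Local Open Scope ring_scope.

Record graph := Graph {
  vertex : countType;
  edge : countType;
  src : edge -> vertex;
  rng : edge -> vertex }.

Section Graph.
Variable E : graph.

Definition emitted (v : vertex E) : set (edge E) := [set e | src e = v].

Definition row_finite := forall v : vertex E, finite_set (emitted v).

Definition regular (v : vertex E) :=
  emitted v !=set0 /\ finite_set (emitted v).

(* The edge sequence e :: p stands for the path of positive length with first
   edge e, so its source is [src e] and its range is [rng (last e p)]. *)
Definition is_path (e : edge E) (p : seq (edge E)) :=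
  path (fun f g => rng f == src g) e p.

Definition is_cycle (e : edge E) (p : seq (edge E)) :=
  is_path e p /\ src e = rng (last e p).

Definition is_exit (f : edge E) (e : edge E) (p : seq (edge E)) :=
  exists2 g, g \in e :: p & src f = src g /\ f <> g.

Definition condition_L :=
  forall e p, is_cycle e p -> exists f, is_exit f e p.

Definition hereditary (H : set (vertex E)) :=
  forall e : edge E, H (src e) -> H (rng e).

(* Only used for hereditary H. *)
Definition saturated (H : set (vertex E)) :=
  forall v, regular v -> (@rng E) @` emitted v `<=` H -> H v.

End Graph.

(* nu = non-unital: no unit is required, nor commutativity. *)

HB.mixin Record Lmodule_isNuAlgebra (R : comNzRingType) V
    of GRing.Lmodule R V := {
  numul : V -> V -> V;
  numulA : associative numul;
  numulDl : left_distributive numul +%R;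
  numulDr : right_distributive numul +%R;
  nuscalerAl : forall (k : R) (x y : V), k *: numul x y = numul (k *: x) y;
  nuscalerAr : forall (k : R) (x y : V), k *: numul x y = numul x (k *: y) }.

#[short(type="nuAlgType")]
HB.structure Definition NuAlgebra (R : comNzRingType) :=
  { V of GRing.Lmodule R V & Lmodule_isNuAlgebra R V }.

Notation "x ** y" := (numul x y) (at level 40, left associativity) : ring_scope.

(* Ideals are ideals of the underlying ring: stability under scalars is not
   required. *)
Record two_sided_ideal (R : comNzRingType) (A : nuAlgType R) (I : set A) : Prop
    := TwoSidedIdeal {
  ideal0 : I 0;
  idealB : forall x y, I x -> I y -> I (x - y);
  idealMl : forall a x, I x -> I (a ** x);
  idealMr : forall a x, I x -> I (x ** a) }.

Record subalgebra (R : comNzRingType) (A : nuAlgType R) (S : set A) : Prop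
    := Subalgebra {
  subalg0 : S 0;
  subalgB : forall x y, S x -> S y -> S (x - y);
  subalgZ : forall (k : R) x, S x -> S (k *: x);
  subalgM : forall x y, S x -> S y -> S (x ** y) }.

(* [fstar F e] is the element e^*. *)
Record generators (E : graph) (T : Type) := Generators {
  fvert : vertex E -> T;
  fedge : edge E -> T;
  fstar : edge E -> T }.

Record leavitt_family (R : comNzRingType) (E : graph) (A : nuAlgType R)
    (F : generators E A) : Prop := LeavittFamily {
  lf_idem : forall v, fvert F v ** fvert F v = fvert F v;
  lf_orth : forall v w, v <> w -> fvert F v ** fvert F w = 0;
  lf_srce : forall e, fvert F (src e) ** fedge F e = fedge F e;
  lf_rnge : forall e, fedge F e ** fvert F (rng e) = fedge F e;
  lf_rngs : forall e, fvert F (rng e) ** fstar F e = fstar F e;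
  lf_srcs : forall e, fstar F e ** fvert F (src e) = fstar F e;
  lf_ck1 : forall e f,
    fstar F e ** fedge F f = if e == f then fvert F (rng e) else 0;
  lf_ck2 : forall v, regular v ->
    fvert F v = \sum_(e \in emitted v) (fedge F e ** fstar F e) }.

(* [leavitt_path_algebra F] says that the algebra L carrying F is
   L_R(E), with F its canonical generators. *)
Record leavitt_path_algebra (R : comNzRingType) (E : graph) (L : nuAlgType R)
    (F : generators E L) : Prop := LeavittPathAlgebra {
  lpa_family : leavitt_family F;
  lpa_generated : forall S : set L, subalgebra S ->
    (forall v, S (fvert F v)) -> (forall e, S (fedge F e)) ->
    (forall e, S (fstar F e)) -> S = setT;
  lpa_universal : forall (A : nuAlgType R) (G : generators E A),
    leavitt_family G ->
    exists f : {linear L -> A}, [/\ {morph f : x y / x ** y >-> x ** y},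
      forall v, f (fvert F v) = fvert G v,
      forall e, f (fedge F e) = fedge G e &
      forall e, f (fstar F e) = fstar G e] }.

Definition basic (R : comNzRingType) (E : graph) (L : nuAlgType R)
    (F : generators E L) (I : set L) :=
  forall (k : R) (v : vertex E), k != 0 -> I (k *: fvert F v) -> I (fvert F v).

Definition basically_simple (R : comNzRingType) (E : graph) (L : nuAlgType R)
    (F : generators E L) :=
  forall I : set L, two_sided_ideal I -> basic F I -> I = [set 0] \/ I = setT.

(* Existence of L_R(E): formal expressions in the generators, two of them being
    identified when they agree in every Leavitt family. *)

Module Existence.
Section Existence.
Local Open Scope quotient_scope.
Variables (R : comNzRingType) (E : graph).

Inductive term :=
| TV of vertex E | TE of edge E | TS of edge E
| T0 | TN of term | TD of term & term | TM of term & term | TZ of R & term.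

HB.instance Definition _ := gen_eqMixin term.
HB.instance Definition _ := gen_choiceMixin term.

Fixpoint eval (A : nuAlgType R) (G : generators E A) (t : term) : A :=
  match t with
  | TV v => fvert G v | TE e => fedge G e | TS e => fstar G e
  | T0 => 0 | TN t => - eval G t | TD t u => eval G t + eval G u
  | TM t u => eval G t ** eval G u | TZ k t => k *: eval G t
  end.

Definition agree (t u : term) := forall (A : nuAlgType R) (G : generators E A),
  leavitt_family G -> eval G t = eval G u.

Definition agreeb : rel term := fun t u => `[< agree t u >].

Lemma agreeb_refl : reflexive agreeb.
Proof. by move=> t; apply/asboolP. Qed.

Lemma agreeb_sym : symmetric agreeb.
Proof.
by move=> t u; apply/asboolP/asboolP => tu A G hG; rewrite (tu A G hG).
Qed.

Lemma agreeb_trans : transitive agreeb.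
Proof.
move=> t u v /asboolP ut /asboolP tv; apply/asboolP => A G hG.
by rewrite (ut A G hG) (tv A G hG).
Qed.

Canonical agree_equiv := EquivRel agreeb agreeb_refl agreeb_sym agreeb_trans.

Definition lpa := {eq_quot agree_equiv}.
HB.instance Definition _ := Choice.on lpa.

Definition cls (t : term) : lpa := \pi_lpa t.
Definition ev (A : nuAlgType R) (G : generators E A) (x : lpa) := eval G (repr x).

Lemma ev_cls (A : nuAlgType R) (G : generators E A) t :
  leavitt_family G -> ev G (cls t) = eval G t.
Proof.
move=> hG; rewrite /ev.
have /eqmodP/asboolP : \pi_lpa (repr (cls t)) = \pi_lpa t by rewrite reprK.
exact.
Qed.

Lemma lpa_ext (x y : lpa) : (forall (A : nuAlgType R) (G : generators E A),
  leavitt_family G -> ev G x = ev G y) -> x = y.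
Proof.
by move=> xy; rewrite -(reprK x) -(reprK y); apply/eqmodP/asboolP.
Qed.

Definition lpa0 := cls T0.
Definition lpaN (x : lpa) : lpa := cls (TN (repr x)).
Definition lpaD (x y : lpa) : lpa := cls (TD (repr x) (repr y)).
Definition lpaM (x y : lpa) : lpa := cls (TM (repr x) (repr y)).
Definition lpaZ (k : R) (x : lpa) : lpa := cls (TZ k (repr x)).

Lemma ev0 (A : nuAlgType R) (G : generators E A) :
  leavitt_family G -> ev G lpa0 = 0.
Proof. by move=> hG; rewrite ev_cls. Qed.
Lemma evN (A : nuAlgType R) (G : generators E A) x :
  leavitt_family G -> ev G (lpaN x) = - ev G x.
Proof. by move=> hG; rewrite ev_cls. Qed.
Lemma evD (A : nuAlgType R) (G : generators E A) x y :
  leavitt_family G -> ev G (lpaD x y) = ev G x + ev G y.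
Proof. by move=> hG; rewrite ev_cls. Qed.
Lemma evM (A : nuAlgType R) (G : generators E A) x y :
  leavitt_family G -> ev G (lpaM x y) = ev G x ** ev G y.
Proof. by move=> hG; rewrite ev_cls. Qed.
Lemma evZ (A : nuAlgType R) (G : generators E A) k x :
  leavitt_family G -> ev G (lpaZ k x) = k *: ev G x.
Proof. by move=> hG; rewrite ev_cls. Qed.

Let lpa_law := (ev0, evN, evD, evM, evZ).

Lemma lpaDA : associative lpaD.
Proof. by move=> x y z; apply: lpa_ext => A G hG; rewrite !lpa_law// addrA. Qed.
Lemma lpaDC : commutative lpaD.
Proof. by move=> x y; apply: lpa_ext => A G hG; rewrite !lpa_law// addrC. Qed.
Lemma lpa0D : left_id lpa0 lpaD.
Proof. by move=> x; apply: lpa_ext => A G hG; rewrite !lpa_law// add0r. Qed.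
Lemma lpaND : left_inverse lpa0 lpaN lpaD.
Proof. by move=> x; apply: lpa_ext => A G hG; rewrite !lpa_law// addNr. Qed.

HB.instance Definition _ :=
  GRing.isZmodule.Build lpa lpaDA lpaDC lpa0D lpaND.

Lemma lpaZA a b x : lpaZ a (lpaZ b x) = lpaZ (a * b) x.
Proof. by apply: lpa_ext => A G hG; rewrite !lpa_law// scalerA. Qed.
Lemma lpa1Z : left_id 1 lpaZ.
Proof. by move=> x; apply: lpa_ext => A G hG; rewrite !lpa_law// scale1r. Qed.
Lemma lpaZDr : right_distributive lpaZ +%R.
Proof. by move=> a x y; apply: lpa_ext => A G hG; rewrite !lpa_law// scalerDr. Qed.
Lemma lpaZDl x : {morph lpaZ^~ x : a b / a + b}.
Proof. by move=> a b; apply: lpa_ext => A G hG; rewrite !lpa_law// scalerDl. Qed.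

HB.instance Definition _ :=
  GRing.Zmodule_isLmodule.Build R lpa lpaZA lpa1Z lpaZDr lpaZDl.

Lemma lpaMA : associative lpaM.
Proof. by move=> x y z; apply: lpa_ext => A G hG; rewrite !lpa_law// numulA. Qed.
Lemma lpaMDl : left_distributive lpaM +%R.
Proof. by move=> x y z; apply: lpa_ext => A G hG; rewrite !lpa_law// numulDl. Qed.
Lemma lpaMDr : right_distributive lpaM +%R.
Proof. by move=> x y z; apply: lpa_ext => A G hG; rewrite !lpa_law// numulDr. Qed.
Lemma lpaZAl (k : R) (x y : lpa) : k *: lpaM x y = lpaM (k *: x) y.
Proof. by apply: lpa_ext => A G hG; rewrite !lpa_law// nuscalerAl. Qed.
Lemma lpaZAr (k : R) (x y : lpa) : k *: lpaM x y = lpaM x (k *: y).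
Proof. by apply: lpa_ext => A G hG; rewrite !lpa_law// nuscalerAr. Qed.

HB.instance Definition _ :=
  Lmodule_isNuAlgebra.Build R lpa lpaMA lpaMDl lpaMDr lpaZAl lpaZAr.

Definition lpa_gen : generators E lpa :=
  Generators (cls \o TV) (cls \o TE) (cls \o TS).

Lemma clsE t : cls t = eval lpa_gen t.
Proof.
elim: t => //= [t <-|t <- u <-|t <- u <-|k t <-]; apply: lpa_ext => A G hG;
  by rewrite ?lpa_law// !ev_cls.
Qed.

Lemma ev_sum (A : nuAlgType R) (G : generators E A) (s : seq (edge E))
    (f : edge E -> lpa) : leavitt_family G ->
  ev G (\sum_(e <- s) f e) = \sum_(e <- s) ev G (f e).
Proof.
move=> hG; elim: s => [|e s IH]; first by rewrite !big_nil ev0.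
by rewrite !big_cons evD// IH.
Qed.

Lemma lpa_genP : leavitt_family lpa_gen.
Proof.
split=> [v|v w vw|e|e|e|e|e f|v [v0 vf]]; apply: lpa_ext => A G hG.
- by rewrite evM// !ev_cls//= (lf_idem hG).
- by rewrite evM// !ev_cls//= (lf_orth hG).
- by rewrite evM// !ev_cls//= (lf_srce hG).
- by rewrite evM// !ev_cls//= (lf_rnge hG).
- by rewrite evM// !ev_cls//= (lf_rngs hG).
- by rewrite evM// !ev_cls//= (lf_srcs hG).
- by rewrite evM// !ev_cls//= (lf_ck1 hG); case: eqP; rewrite ?ev_cls ?ev0.
- rewrite ev_cls//= (lf_ck2 hG)// !fsbig_finite//= ev_sum//.
  by apply: eq_bigr => e _; rewrite evM// !ev_cls.
Qed.

Lemma lpa_is_leavitt_path_algebra : leavitt_path_algebra lpa_gen.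
Proof.
split; first exact: lpa_genP.
- move=> S [S0 SB SZ SM] Sv Se Ss; apply/seteqP; split=> // x _.
  rewrite -(reprK x) -/(cls _) clsE.
  elim: (repr x) => //= [t St|t St u Su|t St u Su|k t St].
  + by rewrite -sub0r; exact: SB.
  + by rewrite -[eval _ u]opprK; apply: (SB) => //; rewrite -sub0r; exact: SB.
  + exact: SM.
  + exact: SZ.
- move=> A G hG.
  have evlin : linear (ev G : lpa -> A) by move=> k x y; rewrite evD// evZ.
  pose f : {linear lpa -> A} :=
    HB.pack (ev G : lpa -> A) (GRing.isLinear.Build R lpa A *:%R (ev G) evlin).
  by exists f; split=> [x y|v|e|e] /=; rewrite ?evM// ev_cls.
Qed.

Theorem leavitt_path_algebra_exists :
  exists (L : nuAlgType R) (F : generators E L), leavitt_path_algebra F.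
Proof. by exists lpa, lpa_gen; exact: lpa_is_leavitt_path_algebra. Qed.

End Existence.
End Existence.

(* Main.v *)
From HB Require Import structures.
From mathcomp Require Import all_boot all_algebra.
From mathcomp Require Import finmap.
From mathcomp Require Import boolp classical_sets functions cardinality fsbigop.
Require Import Defs.

(**
Write V v, e and e^* for the generators of L = L_R(E).

Sufficiency rests on a reduction: under Condition (L), every nonzero x in L
satisfies a x b = k V v for some a, b in L, some nonzero k in R and some
vertex v ([reduction]). A nonzero basic ideal I therefore contains a vertex.
The Leavitt relations make the set of vertices in I hereditary and saturated,
so I contains every vertex and is all of L. The reduction has two stages. A
vertex that emits edges is the sum of its e e^*, so x V v <> 0 gives x e <> 0
for some edge e, and multiplying by e consumes one ghost edge on the right of
x; after finitely many steps x has become a nonzero combination y of real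
paths ([reduction_to_real]). Let then p be one of the shortest paths of y.
Multiplying y on the left by p^* turns it into k V v + sum_i k_i q_i with
paths q_i of positive length. Every cycle has an exit, so there is a path g
from v which is not an initial segment of the infinite word q_i q_i q_i ... for any
closed q_i ([avoid_closed_paths]), which says that g^* q_i g = 0; hence
g^* (p^* y) g is k times the range of g.

Necessity rests on concrete representations. Give each vertex v outside a
saturated hereditary set H a copy D_v of nat * int, and let the edges that
leave v without entering H split D_v: if there are n of them, the one of index
i identifies the D_(rng e) with the residue class of i modulo n in D_v, and
shifts the integer by a constant d. Functions on the union of the D_v carry
the resulting Leavitt family ([branching_family]), in which V v = 0 for v in
H, and k V v = 0 forces k = 0 otherwise. The kernel of the corresponding map
out of L is thus a basic ideal, so it is 0 as soon as H is proper. It contains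
H, and vertices are nonzero in L ([vert_neq0]), so H is empty. If a cycle alpha based at v
had no exit, every vertex on it would emit one edge, so alpha would act as V v
for H empty and d = 0, giving alpha = V v in L; but for d = 1 it shifts the
integer by its length.
*)

Set Implicit Arguments.
Unset Strict Implicit.
Unset Printing Implicit Defensive.

Import GRing.Theory.

Local Open Scope classical_set_scope.
Local Open Scope ring_scope.

(** * The algebra of endomorphisms of a function space *)

Section EndAlgebra.
Variables (R : comNzRingType) (X : Type).
Local Notation U := (X -> R^o).

(** A predicate on plain functions, so that the endomorphisms of U form a
    submodule of the functions from U to U and inherit its module structure. *)
Definition islinear : {pred U -> U} := fun f => `[< linear f >].

Lemma islinear_closed : submod_closed islinear.
Proof.
split=> [|k f g /asboolP lf /asboolP lg]; apply/asboolP => c u v.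
  by rewrite /= scaler0 addr0.
rewrite !fctE lf lg; apply: funext => x; rewrite !fctE.
by rewrite !scalerDr !scalerA [k * c]mulrC -!addrA; congr (_ + _);
   rewrite addrCA.
Qed.

HB.instance Definition _ :=
  GRing.isSubmodClosed.Build R (U -> U) islinear islinear_closed.

Record endo := Endo { endo_fun :> U -> U; _ : islinear endo_fun }.
HB.instance Definition _ := [isSub for endo_fun].
HB.instance Definition _ := [Choice of endo by <:].
HB.instance Definition _ := [SubChoice_isSubLmodule of endo by <:].

Lemma endo_linear (f : endo) : linear f.
Proof. by have /asboolP := valP f. Qed.

Lemma endo_ext (f g : endo) : f =1 g -> f = g.
Proof. by move=> fg; apply: val_inj; apply: funext => u; exact: fg. Qed.

Lemma endoD (f : endo) u v : f (u + v) = f u + f v.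
Proof. by have := endo_linear f 1 u v; rewrite !scale1r. Qed.

Lemma endo0 (f : endo) : f 0 = 0.
Proof. by apply: (addrI (f 0)); rewrite -endoD !addr0. Qed.

Lemma endoZ (f : endo) k u : f (k *: u) = k *: f u.
Proof. by have := endo_linear f k u 0; rewrite endo0 !addr0. Qed.

Lemma comp_islinear (f g : endo) : islinear (f \o g).
Proof. by apply/asboolP => k u v /=; rewrite !endoD !endoZ. Qed.

Definition endo_mul (f g : endo) : endo := Endo (comp_islinear f g).

Lemma endo_scaleE k (f : endo) u : (k *: f) u = k *: f u. Proof. by []. Qed.

Fact endo_mulA : associative endo_mul.
Proof. by move=> f g h; apply: endo_ext. Qed.
Fact endo_mulDl : left_distributive endo_mul +%R.
Proof. by move=> f g h; apply: endo_ext. Qed.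
Fact endo_mulDr : right_distributive endo_mul +%R.
Proof. by move=> f g h; apply: endo_ext => u; exact: endoD. Qed.
Fact endo_scalerAl (k : R) (f g : endo) :
  k *: endo_mul f g = endo_mul (k *: f) g.
Proof. exact: endo_ext. Qed.
Fact endo_scalerAr (k : R) (f g : endo) :
  k *: endo_mul f g = endo_mul f (k *: g).
Proof. by apply: endo_ext => u; rewrite !endo_scaleE /= endoZ. Qed.

HB.instance Definition _ := Lmodule_isNuAlgebra.Build R endo
  endo_mulA endo_mulDl endo_mulDr endo_scalerAl endo_scalerAr.

Lemma endo_mulE (f g : endo) u : (f ** g) u = f (g u). Proof. by []. Qed.

End EndAlgebra.

(** * Endomorphisms induced by partial maps *)

Section PartialMaps.
Variables (R : comNzRingType) (X : Type).
Implicit Types h : X -> option X.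

Definition pull_fun h (u : X -> R^o) : X -> R^o :=
  fun x => if h x is Some y then u y else 0.

Lemma pull_islinear h : islinear (pull_fun h).
Proof.
apply/asboolP => k u v; apply: funext => x; rewrite !fctE /pull_fun.
by case: (h x) => //; rewrite scaler0 addr0.
Qed.

Definition pull h : endo R X := Endo (pull_islinear h).

(** Composing the endomorphisms composes the partial maps in the opposite
    order, so the Leavitt relations can be checked on points. *)
Lemma pullM h1 h2 : pull h1 ** pull h2 = pull (obind h2 \o h1).
Proof.
apply: endo_ext => u; apply: funext => x /=; rewrite /pull_fun /=.
by case: (h1 x).
Qed.

Lemma pull_eq h1 h2 : h1 =1 h2 -> pull h1 = pull h2.
Proof. by move=> /funext ->. Qed.

Lemma pull_none h : (forall x, h x = None) -> pull h = 0.
Proof.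
by move=> h0; apply: endo_ext => u; apply: funext => x /=; rewrite /pull_fun h0.
Qed.

Lemma pull_sum (I : eqType) (s : seq I) (h : I -> X -> option X) u x :
  (\sum_(i <- s) pull (h i)) u x = \sum_(i <- s) pull (h i) u x.
Proof. by elim: s => [|i s IH]; rewrite ?big_nil// !big_cons -IH. Qed.

End PartialMaps.

(** * A representation killing a given set of vertices *)

Section BranchingRepresentation.
Variables (R : comNzRingType) (E : graph) (hE : row_finite E).
Variables (H : set (vertex E)) (d : int).
Hypotheses (Hher : hereditary H) (Hsat : saturated H).

Local Notation X := (vertex E * nat * int)%type.

(** Only these edges survive in the representation: edges entering H must act
    as 0. *)
Definition out (v : vertex E) : seq (edge E) :=
  [seq e <- fset_set (emitted v) | rng e \notin H].

Lemma mem_out e v : (e \in out v) = (src e == v) && (rng e \notin H).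
Proof.
rewrite mem_filter andbC in_fset_set//; congr (_ && _).
by apply/idP/eqP => [/set_mem|/mem_set].
Qed.

Lemma out_uniq v : uniq (out v).
Proof. by rewrite filter_uniq ?fset_uniq. Qed.

Lemma src_notin e : rng e \notin H -> src e \notin H.
Proof. by apply: contra => /set_mem/Hher/mem_set. Qed.

(** A point (w, m, j) is the point (m, j) of D_w. The maps of e and e^* are
    mutually inverse bijections between a residue class in D_(src e) and
    D_(rng e): Euclidean division by the number of edges recovers the edge as the
    remainder. *)
Definition vmap v (x : X) := if (x.1.1 == v) && (v \notin H) then Some x else None.
Definition emap e (x : X) : option X := let: (w, m, j) := x in
  if (e \in out w) && (m %% size (out w) == index e (out w))%N
  then Some (rng e, (m %/ size (out w))%N, j - d) else None.
Definition smap e (x : X) : option X := let: (w, m, j) := x in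
  if (w == rng e) && (rng e \notin H)
  then Some (src e, (m * size (out (src e)) + index e (out (src e)))%N, j + d)
  else None.

Definition branching : generators E (endo R X) :=
  Generators (fun v => pull R (vmap v)) (fun e => pull R (emap e))
             (fun e => pull R (smap e)).

(** The delicate relation is the last one: that v is the sum of the e e^*
    says that each m has exactly one remainder, which needs [out v] to be
    nonempty. This is where saturation of H enters. Hereditariness gives the
    source of an edge outside H when its range is outside H. *)
Lemma branching_family : leavitt_family branching.
Proof.
split=> /= [v|v w vw|e|e|e|e|e f|v [[e0 e0v] vf]]; rewrite ?pullM.
- apply: pull_eq => -[[w m] j] /=; rewrite /vmap /=.
  by case: ifP => //= ->.
- apply: pull_none => -[[u m] j] /=; rewrite /vmap /=.
  by case: ifP => //= /andP[/eqP -> _]; case: eqP.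
- apply: pull_eq => -[[w m] j] /=; rewrite /vmap /=.
  case: ifPn => //= h; case: ifP => // /andP[]; rewrite mem_out => /andP[/eqP sw r].
  by rewrite -sw eqxx src_notin in h.
- apply: pull_eq => -[[w m] j] /=; rewrite /vmap /=.
  case: ifP => //= /andP[]; rewrite mem_out => /andP[_ ->].
  by rewrite eqxx.
- apply: pull_eq => -[[w m] j] /=; rewrite /vmap /=.
  by case: (eqVneq w (rng e)) => //= we; case: ifP => //= r; rewrite we eqxx r.
- apply: pull_eq => -[[w m] j] /=; rewrite /vmap /=.
  by case: ifP => //= /andP[_ r]; rewrite eqxx src_notin.
- have -> : (if e == f then pull R (vmap (rng e)) else 0) =
      pull R (fun x => if e == f then vmap (rng e) x else None).
    by case: eqP => // _; rewrite pull_none.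
  apply: pull_eq => -[[w m] j] /=; rewrite /vmap /=.
  case: (eqVneq w (rng e)) => [->|]/=; last by rewrite if_same.
  case: ifPn => /= r; last by rewrite if_same.
  rewrite mem_out; have eo : e \in out (src e) by rewrite mem_out eqxx.
  case: (eqVneq e f) => [<-|ef].
    rewrite eqxx r/= modnMDl.
    have i : (index e (out (src e)) < size (out (src e)))%N by rewrite index_mem.
    rewrite modn_small// eqxx/= divnMDl ?divn_small ?addn0 ?addrK//.
    exact: leq_ltn_trans i.
  case: ifP => // /andP[/andP[/eqP sf rf]].
  rewrite modnMDl modn_small ?index_mem// => /eqP i.
  have fo : f \in out (src e) by rewrite mem_out sf eqxx.
  by move: ef; rewrite -(nth_index e eo) i nth_index ?eqxx.
- rewrite fsbig_finite//=.
  have -> : \sum_(e <- fset_set (emitted v)) pull R (emap e) ** pull R (smap e)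
      = \sum_(e <- out v) pull R (obind (smap e) \o emap e).
    rewrite /out big_filter [RHS]big_mkcond /=; apply: eq_bigr => e _.
    rewrite pullM; case: ifPn => // r; apply: pull_none => -[[w m] j] /=.
    by rewrite mem_out (negbTE r) andbF.
  apply: endo_ext => u; apply: funext => -[[w m] j].
  rewrite pull_sum /= /pull_fun /vmap /=.
  (* At a point of D_v, only the edge selected by the remainder of m contributes. *)
  case: (eqVneq w v) => [->{w}|wv] /=; last first.
    rewrite big_seq big1// => e; rewrite !mem_out => /andP[/eqP-> _].
    by rewrite eq_sym (negbTE wv).
  case: ifPn => [vH|/negPn vH]; last first.
    rewrite big_seq big1// => e; rewrite mem_out => /andP[/eqP se /src_notin].
    by rewrite se vH.
  have n0 : (0 < size (out v))%N.
    rewrite lt0n size_eq0; apply/negP => /eqP out0.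
    move/negP: vH; apply; apply/mem_set/Hsat; first by split=> //; exists e0.
    move=> _ [e ev <-]; apply/set_mem; apply/negPn/negP => r.
    by have := mem_out e v; rewrite out0 r ev eqxx.
  pose e := nth e0 (out v) (m %% size (out v)).
  have mn : (m %% size (out v) < size (out v))%N by rewrite ltn_pmod.
  have eo : e \in out v by rewrite mem_nth.
  rewrite (bigD1_seq e) ?out_uniq//= eo index_uniq ?out_uniq// eqxx/=.
  have := eo; rewrite mem_out => /andP[/eqP se r]; rewrite eqxx r/= se.
  rewrite index_uniq ?out_uniq// -divn_eq addrNK big1_seq ?addr0//.
  move=> f /andP[fe fo]; rewrite fo/=; case: ifPn => // /eqP i.
  by move: fe; rewrite /e i nth_index// eqxx.
Qed.

Lemma vert_apply v (u : X -> R^o) w m j :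
  fvert branching v u (w, m, j) = if (w == v) && (v \notin H) then u (w, m, j) else 0.
Proof. by rewrite /= /pull_fun /vmap; case: ifP. Qed.

(** This freeness is what makes kernels of maps to the representation basic. *)
Lemma vert_torsion_free (k : R) v :
  v \notin H -> k *: fvert branching v = 0 -> k = 0.
Proof.
move=> vH /(congr1 (fun f : endo R X => f (fun=> 1) (v, 0%N, 0))).
rewrite endo_scaleE fctE vert_apply eqxx vH /= => k0.
by rewrite -[k]mulr1; exact: k0.
Qed.

Lemma vert_in v : v \in H -> fvert branching v = 0.
Proof.
move=> vH; apply: endo_ext => u; apply: funext => -[[w m] j].
by rewrite vert_apply vH andbF.
Qed.

(** The only edge leaving a vertex splits D_(src e) into a single class, so it
    acts as the identity on the nat coordinate. *)
Lemma edge_apply e (u : X -> R^o) m j : rng e \notin H ->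
  (forall f, src f = src e -> f = e) ->
  fedge branching e u (src e, m, j) = u (rng e, m, j - d).
Proof.
move=> r only; have oe : out (src e) = [:: e].
  apply: perm_small_eq => //; apply: uniq_perm; rewrite ?out_uniq// => f.
  rewrite mem_out inE; apply/andP/eqP => [[/eqP/only//]|->].
  by rewrite eqxx.
by rewrite /= /pull_fun /emap oe inE eqxx /= modn1 divn1 eqxx.
Qed.

End BranchingRepresentation.

(** * Algebras without unit *)

Section NonUnitalAlgebra.
Variables (R : comNzRingType) (A : nuAlgType R).
Implicit Types (x y : A) (k : R).

Lemma numul0r x : x ** 0 = 0.
Proof. by apply: (addrI (x ** 0)); rewrite -numulDr !addr0. Qed.

Lemma numul0l x : 0 ** x = 0.
Proof. by apply: (addrI (0 ** x)); rewrite -numulDl !addr0. Qed.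

Lemma numulBl x y z : (y - z) ** x = y ** x - z ** x.
Proof.
by apply: (addIr (z ** x)); rewrite -numulDl !addrNK.
Qed.

Lemma numul_sumr (I : Type) (s : seq I) (P : pred I) (a : I -> A) x :
  x ** (\sum_(i <- s | P i) a i) = \sum_(i <- s | P i) (x ** a i).
Proof. exact: (big_morph _ (numulDr x) (numul0r x)). Qed.

Lemma numul_suml (I : Type) (s : seq I) (P : pred I) (a : I -> A) x :
  (\sum_(i <- s | P i) a i) ** x = \sum_(i <- s | P i) (a i ** x).
Proof. exact: (big_morph (numul^~ x) (fun y z => numulDl y z x) (numul0l x)). Qed.

End NonUnitalAlgebra.

Section Kernel.
Variables (R : comNzRingType) (A B : nuAlgType R) (f : {linear A -> B}).
Hypothesis fM : {morph f : x y / x ** y >-> x ** y}.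

Lemma kernel_ideal : two_sided_ideal [set x | f x = 0].
Proof.
split=> [|x y fx fy|a x fx|a x fx] /=; first exact: linear0.
- by rewrite linearB fx fy subr0.
- by rewrite fM fx numul0r.
- by rewrite fM fx numul0l.
Qed.

End Kernel.

(** * Paths *)

Section Paths.
Variable E : graph.
Implicit Types (v : vertex E) (e f : edge E) (p q : seq (edge E)).

Fixpoint is_path_from v p : bool :=
  if p is e :: q then (src e == v) && is_path_from (rng e) q else true.

Definition path_end v p : vertex E := last v (map (@rng E) p).

Lemma is_path_fromE e p : is_path_from (src e) (e :: p) = is_path e p.
Proof.
rewrite /= eqxx /is_path; elim: p e => //= f p IH e.
by rewrite -IH eq_sym; case: eqP => //= ->.
Qed.

Lemma path_end_cons v e p : path_end v (e :: p) = rng (last e p).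
Proof. by rewrite /path_end /= last_map. Qed.

Lemma path_end_cat v p q : path_end v (p ++ q) = path_end (path_end v p) q.
Proof. by rewrite /path_end map_cat last_cat. Qed.

Lemma is_path_from_cat v p q :
  is_path_from v (p ++ q) = is_path_from v p && is_path_from (path_end v p) q.
Proof. by elim: p v => //= e p IH v; rewrite IH andbA. Qed.

End Paths.

(** * Real paths *)

Section Monomials.
Variables (R : comNzRingType) (E : graph).

(** The element vanishes unless [p] is a path from [v], so products of paths
    can be formed without compatibility proofs. *)
Fixpoint real_path (A : nuAlgType R) (G : generators E A) v p : A :=
  if p is e :: q then fvert G v ** (fedge G e ** real_path G (rng e) q)
  else fvert G v.

Lemma real_path_nil (A : nuAlgType R) (G : generators E A) v :
  real_path G v [::] = fvert G v.
Proof. by []. Qed.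

Lemma real_path_cons (A : nuAlgType R) (G : generators E A) v e p :
  real_path G v (e :: p) = fvert G v ** (fedge G e ** real_path G (rng e) p).
Proof. by []. Qed.

Lemma real_path_morph (A B : nuAlgType R) (F : generators E A)
    (G : generators E B) (f : {linear A -> B}) :
  {morph f : x y / x ** y >-> x ** y} ->
  (forall v, f (fvert F v) = fvert G v) ->
  (forall e, f (fedge F e) = fedge G e) ->
  forall v p, f (real_path F v p) = real_path G v p.
Proof.
move=> fM fv fe v p; elim: p v => [|e p IH] v //=.
by rewrite !fM fv fe IH.
Qed.

End Monomials.

(** Along a path all of whose vertices emit one edge, only the integer
    coordinate remembers how far one has moved. *)
Lemma real_path_apply (R : comNzRingType) (E : graph) (hE : row_finite E) d v p
    (u : vertex E * nat * int -> R^o) m j :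
  is_path_from v p -> (forall e f, e \in p -> src f = src e -> f = e) ->
  real_path (branching R set0 d) v p u (v, m, j) =
    u (path_end v p, m, j - d *+ size p).
Proof.
have nH w : w \notin (set0 : set (vertex E)) by rewrite in_set0.
elim: p v j => [|e p IH] v j.
  by move=> _ _; rewrite real_path_nil vert_apply eqxx nH subr0.
move=> /andP[/eqP <- vp] only.
rewrite real_path_cons !endo_mulE vert_apply eqxx nH.
rewrite edge_apply//; last by move=> f; apply: only; rewrite inE eqxx.
rewrite IH//; last by move=> g f gp; apply: only; rewrite inE gp orbT.
by rewrite mulrS opprD addrA.
Qed.

(** * Necessity of the two conditions *)

Section Necessity.
Variables (R : comNzRingType) (E : graph) (hE : row_finite E).
Variables (L : nuAlgType R) (F : generators E L).
Hypothesis hL : leavitt_path_algebra F.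

(** The kernel of [f] is a basic ideal missing a vertex outside H, so basic
    simplicity leaves only the zero ideal. *)
Lemma branching_kernel (H : set (vertex E)) d :
  basically_simple F -> hereditary H -> saturated H ->
  (exists v, ~ H v) ->
  forall f : {linear L -> endo R (vertex E * nat * int)},
    {morph f : x y / x ** y >-> x ** y} ->
    (forall v, f (fvert F v) = fvert (branching R H d) v) ->
  forall x, f x = 0 -> x = 0.
Proof.
move=> simp hH sH [w wH] f fM fv x fx.
have bas : basic F [set x | f x = 0].
  move=> k v k0 /=; rewrite linearZ/= fv => kv.
  case: (boolP (v \in H)) => vH; first exact: vert_in.
  by have := vert_torsion_free vH kv => /eqP; rewrite (negbTE k0).
have [kerE|kerE] := simp _ (kernel_ideal fM) bas.
  by have : [set x | f x = 0] x by []; rewrite kerE.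
have : [set x | f x = 0] (fvert F w) by rewrite kerE.
rewrite /= fv -[fvert _ w]scale1r => w0; exfalso.
have wH' : w \notin H by apply/negP => /set_mem.
by have := vert_torsion_free wH' w0 => /eqP; rewrite oner_eq0.
Qed.

Lemma saturated_set0 : saturated (set0 : set (vertex E)).
Proof. by move=> v [[e ev] _] /(_ (rng e)); apply; exists e. Qed.

Lemma hereditary_set0 : hereditary (set0 : set (vertex E)).
Proof. by []. Qed.

Lemma vert_neq0 v : fvert F v <> 0.
Proof.
move=> v0; have [f [_ fv _ _]] := lpa_universal hL
  (branching_family R hE 0 hereditary_set0 saturated_set0).
have vH : v \notin (set0 : set (vertex E)) by rewrite in_set0.
have := vert_torsion_free (R := R) (k := 1) (d := 0) vH.
rewrite -fv v0 linear0 scaler0 => /(_ erefl)/eqP.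
by rewrite oner_eq0.
Qed.

Lemma basically_simple_saturated : basically_simple F ->
  forall H : set (vertex E), hereditary H -> saturated H -> H = set0 \/ H = setT.
Proof.
move=> simp H hH sH.
case: (pselect (exists v, ~ H v)) => [nH|nH]; [left|right]; last first.
  apply/seteqP; split=> // v _; apply: contrapT => vH.
  by apply: nH; exists v.
apply/seteqP; split=> // v vH.
have [f [fM fv _ _]] := lpa_universal hL (branching_family R hE 0 hH sH).
(* A vertex of H would be in the kernel, hence 0. *)
apply: (@vert_neq0 v); apply: (branching_kernel simp hH sH nH fM fv).
by rewrite fv vert_in// mem_set.
Qed.

Lemma basically_simple_condition_L : basically_simple F -> condition_L E.
Proof.
move=> simp e p [ep ecl]; apply: contrapT => noexit.
have only g f : g \in e :: p -> src f = src g -> f = g.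
  by move=> gp fg; apply: contrapT => nfg; apply: noexit; exists f, g.
have vp : is_path_from (src e) (e :: p) by rewrite is_path_fromE.
have pend : path_end (src e) (e :: p) = src e by rewrite path_end_cons -ecl.
have nT : exists v, ~ (set0 : set (vertex E)) v by exists (src e).
(* With d = 0 the cycle and its base vertex act in the same way. *)
have aE : real_path F (src e) (e :: p) = fvert F (src e).
  have [f [fM fv fe _]] := lpa_universal hL
    (branching_family R hE 0 hereditary_set0 saturated_set0).
  apply/eqP; rewrite -subr_eq0; apply/eqP.
  apply: (branching_kernel simp hereditary_set0 saturated_set0 nT fM fv).
  rewrite linearB; apply/eqP; rewrite subr_eq0; apply/eqP.
  rewrite (real_path_morph fM fv fe) fv; apply: endo_ext => u.
  apply: funext => -[[w m] j].
  case: (eqVneq w (src e)) => [->|we].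
    rewrite real_path_apply// pend vert_apply eqxx in_set0 /=.
    by rewrite mul0rn subr0.
  by rewrite [LHS]vert_apply vert_apply (negbTE we).
(* With d = 1 they are told apart by the indicator function of j = 0. *)
have [f [fM fv fe _]] := lpa_universal hL
  (branching_family R hE 1 hereditary_set0 saturated_set0).
have := congr1 f aE; rewrite (real_path_morph fM fv fe) fv.
move=> /(congr1 (fun g : endo R _ => g (fun y => if y.2 == 0 then 1 else 0)
  (src e, 0%N, 0))).
rewrite real_path_apply// vert_apply eqxx.
rewrite in_set0 /= add0r oppr_eq0.
by rewrite Num.Theory.pnatr_eq0 /= => /eqP; rewrite eq_sym oner_eq0.
Qed.

End Necessity.

(** * Paths that are not initial segments of a periodic word *)

Section AvoidingPaths.
Variable E : graph.
Implicit Types (v : vertex E) (e f : edge E) (p q : seq (edge E)).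

Definition closed_path v q := [&& q != [::], is_path_from v q & path_end v q == v].

(** The hypothesis says that p is read off the periodic word q q q ...; for
    large n the conclusion exhibits p inside a power of q. *)
Lemma prefix_power p q n :
  prefix p (q ++ p) -> prefix p (iter n (cat q) p).
Proof.
move=> pq; elim: n => [|n IH] /=; first exact: prefix_refl.
by apply: prefix_trans pq _; rewrite prefix_catr // eqxx.
Qed.

(** Failure to be periodic persists under extension, which allows closed paths
    to be treated one after the other. *)
Lemma nprefix_extend p q r : ~~ prefix p (q ++ p) ->
  ~~ prefix (p ++ r) (q ++ p ++ r).
Proof.
apply: contra => pqr; have : prefix p (q ++ p ++ r).
  exact: prefix_trans (prefix_prefix _ _) pqr.
rewrite !prefixE catA takel_cat//.
by rewrite size_cat leq_addl.
Qed.

Lemma closed_path_exit v q : condition_L E -> closed_path v q ->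
  exists q1 e q2 f, [/\ q = q1 ++ e :: q2, src f = src e & f <> e].
Proof.
move=> cL; case: q => [|e q]; first by case/and3P.
case/and3P=> _ vq /eqP qv; have /= /andP[/eqP se _] := vq.
have [|f [g gq [fg nfg]]] := cL e q.
  by split; [rewrite -is_path_fromE se | rewrite se -[LHS]qv path_end_cons].
have [q1 q2] := splitPr gq.
by exists q1, g, q2, f.
Qed.

(** If p is periodic, follow the power of q that p starts and continue along q
    until its exit: leaving through the exit breaks the period. *)
Lemma avoid_closed_path v q p : condition_L E -> closed_path v q ->
  is_path_from v p ->
  exists r, is_path_from v (p ++ r) /\ ~~ prefix (p ++ r) (q ++ p ++ r).
Proof.
move=> cL vq vp.
case: (boolP (prefix p (q ++ p))) => [pq|npq]; last first.
  by exists [::]; rewrite cats0.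
have [q1 [e [q2 [f [qE fe nfe]]]]] := closed_path_exit cL vq.
case/and3P: (vq) => q0 pathq /eqP endq.
pose qn n := iter n (cat q) [::].
have qnP n : is_path_from v (qn n) /\ path_end v (qn n) = v.
  elim: n => //= n [IH1 IH2].
  by rewrite is_path_from_cat path_end_cat pathq endq.
have qnC n : qn n ++ q = q ++ qn n.
  by elim: n => [|n IH] /=; rewrite ?cats0// -catA IH.
have szqn n : (n <= size (qn n))%N.
  elim: n => //= n IH; rewrite size_cat -add1n leq_add// lt0n size_eq0 //.
(* The power [size p] is long enough to have p as an initial segment. *)
have : prefix p (qn (size p)).
  have := prefix_power (size p) pq.
  have -> : iter (size p) (cat q) p = qn (size p) ++ p.
    by rewrite /qn; elim: (size p) => //= n ->; rewrite catA.
  by rewrite !prefixE takel_cat.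
case/prefixP => r rE; exists (r ++ q1 ++ [:: f]).
have [vqn eqn] := qnP (size p).
have -> : p ++ r ++ q1 ++ [:: f] = qn (size p) ++ q1 ++ [:: f] by rewrite rE -catA.
split.
  rewrite is_path_from_cat vqn eqn /= is_path_from_cat.
  move: pathq; rewrite qE is_path_from_cat /= => /and3P[-> /eqP <- _].
  by rewrite fe eqxx.
rewrite [q ++ _]catA -qnC [in X in prefix _ ((_ ++ X) ++ _)]qE -!catA; apply/negP.
by rewrite prefix_catr// eqxx /= prefix_catr// eqxx /= => /andP[/eqP].
Qed.

Lemma avoid_closed_paths v (Q : seq (seq (edge E))) : condition_L E ->
  exists p, is_path_from v p /\
    forall q, q \in Q -> closed_path v q -> ~~ prefix p (q ++ p).
Proof.
move=> cL; elim: Q => [|q Q [p [vp pQ]]]; first by exists [::].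
case: (boolP (closed_path v q)) => [vq|nvq]; last first.
  exists p; split=> // q'; rewrite inE => /orP[/eqP->|]; last exact: pQ.
  by rewrite (negbTE nvq).
have [r [vpr npr]] := avoid_closed_path cL vq vp.
exists (p ++ r); split=> // q'; rewrite inE => /orP[/eqP->//|q'Q vq'].
by apply: nprefix_extend; exact: pQ.
Qed.

End AvoidingPaths.

(** * Computing in a Leavitt family *)

Section LeavittFamily.
Variables (R : comNzRingType) (E : graph) (L : nuAlgType R).
Variables (F : generators E L) (lf : leavitt_family F).
Implicit Types (v w : vertex E) (e f : edge E) (p q : seq (edge E)).
Local Notation V := (fvert F).
Local Notation P := (real_path F).

Lemma vert_vert v w : V v ** V w = if v == w then V v else 0.
Proof.
by case: eqP => [<-|vw]; [exact: lf_idem|exact: lf_orth].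
Qed.

Lemma vert_edge v e : V v ** fedge F e = if v == src e then fedge F e else 0.
Proof.
rewrite -(lf_srce lf e) numulA vert_vert.
by case: eqP => [->|_]; rewrite ?numul0l.
Qed.

Lemma star_vert e v : fstar F e ** V v = if src e == v then fstar F e else 0.
Proof.
rewrite -(lf_srcs lf e) -numulA vert_vert.
by case: eqP => _; rewrite ?numul0r.
Qed.

Lemma vert_real w v p : V w ** P v p = if w == v then P v p else 0.
Proof.
case: p => [|e p] /=; rewrite ?numulA vert_vert.
  by case: eqP => // ->.
by case: eqP => [->|_]; rewrite ?numul0l.
Qed.

Lemma edge_real e v p :
  fedge F e ** P v p = if rng e == v then P (src e) (e :: p) else 0.
Proof.
case: eqP => [<-|/eqP ev] /=; first by rewrite numulA (lf_srce lf).
rewrite -(lf_rnge lf e) -numulA vert_real (negbTE ev).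
exact: numul0r.
Qed.

Lemma real_cat v p q : P v (p ++ q) = P v p ** P (path_end v p) q.
Proof.
elim: p v => [|e p IH] v /=; first by rewrite vert_real eqxx.
by rewrite IH !numulA.
Qed.

Lemma real_vert v p w : P v p ** V w = if path_end v p == w then P v p else 0.
Proof.
have {1}-> : P v p = P v p ** V (path_end v p) by rewrite -(real_cat _ _ [::]) cats0.
rewrite -numulA vert_vert; case: eqP => _; last exact: numul0r.
by rewrite -(real_cat _ _ [::]) cats0.
Qed.

Lemma real_real v p w q :
  P v p ** P w q = if path_end v p == w then P v (p ++ q) else 0.
Proof.
case: ifPn => [/eqP <-|pw]; first by rewrite real_cat.
rewrite -[P w q]/(P w ([::] ++ q)) real_cat numulA real_vert (negbTE pw).
exact: numul0l.
Qed.

Lemma real_invalid v p : ~~ is_path_from v p -> P v p = 0.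
Proof.
elim: p v => //= e p IH v; rewrite negb_and => /orP[ev|/IH->].
  by rewrite numulA vert_edge eq_sym (negbTE ev) numul0l.
by rewrite !numul0r.
Qed.

Lemma star_real e v f q : fstar F e ** P v (f :: q) =
  if (src e == v) && (e == f) then P (rng e) q else 0.
Proof.
rewrite /= numulA star_vert; case: eqP => _ /=; last exact: numul0l.
rewrite numulA (lf_ck1 lf); case: eqP => [<-|_]; last exact: numul0l.
by rewrite vert_real eqxx.
Qed.

(** Represents p^* when [p] is a path from [v]. *)
Fixpoint ghost_path v p : L :=
  if p is e :: q then ghost_path (rng e) q ** fstar F e else V v.

(** As p is no longer than q, p^* strips it from the front of q if it can, and
    kills q otherwise; no ghost edge is left over. *)
Lemma ghost_real v p w q : is_path_from v p -> (size p <= size q)%N ->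
  ghost_path v p ** P w q =
    if (v == w) && prefix p q then P (path_end v p) (drop (size p) q) else 0.
Proof.
elim: p v w q => [|e p IH] v w [|f q] //.
- by rewrite vert_real andbT; case: eqP => // ->.
- by rewrite vert_real andbT; case: eqP => // ->.
move=> /= /andP[/eqP <- vp] pq; rewrite -numulA star_real.
case: (src e == w) => /=; last exact: numul0r.
case: eqP => /= _; last exact: numul0r.
by rewrite IH// eqxx.
Qed.

(** * Counting ghost edges *)

Definition is_submodule (T : set L) :=
  [/\ T 0, forall x y, T x -> T y -> T (x + y) & forall k x, T x -> T (k *: x)].

Definition real_span : set L := [set x | exists s : seq (R * (vertex E * seq (edge E))),
  x = \sum_(t <- s) t.1 *: P t.2.1 t.2.2].

Lemma real_span_submodule : is_submodule real_span.
Proof.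
split=> [|x y [s ->] [t ->]|k x [s ->]]; first by exists [::]; rewrite big_nil.
  by exists (s ++ t); rewrite big_cat.
exists [seq (k * t.1, t.2) | t <- s]; rewrite big_map scaler_sumr.
by apply: eq_bigr => t _ /=; rewrite scalerA.
Qed.

Lemma real_span_path v p : real_span (P v p).
Proof. by exists [:: (1, (v, p))]; rewrite big_seq1 scale1r. Qed.

Lemma real_span_mull T a : is_submodule T -> (forall v p, T (a ** P v p)) ->
  forall x, real_span x -> T (a ** x).
Proof.
case=> T0 TD TZ Ta _ [s ->]; rewrite numul_sumr.
by apply: big_ind => // t _; rewrite -nuscalerAr; exact: TZ.
Qed.

Lemma real_span_mulr T a : is_submodule T -> (forall v p, T (P v p ** a)) ->
  forall x, real_span x -> T (x ** a).
Proof.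
case=> T0 TD TZ Ta _ [s ->]; rewrite numul_suml.
by apply: big_ind => // t _; rewrite -nuscalerAl; exact: TZ.
Qed.

Lemma real_span_edge e x : real_span x -> real_span (x ** fedge F e).
Proof.
apply: real_span_mulr real_span_submodule _ _ => v p.
have -> : fedge F e = P (src e) [:: e] by rewrite /= (lf_rnge lf) (lf_srce lf).
rewrite real_real; case: ifP => _; first exact: real_span_path.
by case: real_span_submodule.
Qed.

Lemma real_span_vert v x : real_span x -> real_span (x ** V v).
Proof.
apply: real_span_mulr real_span_submodule _ _ => w p.
rewrite real_vert; case: ifP => _; first exact: real_span_path.
by case: real_span_submodule.
Qed.

(** Stands for the ghost paths in x having length at most n: an edge multiplied
    on the right cancels one ghost edge. Phrased in this way, the bound does not
    depend on an expression of x as a sum of monomials. Sinks need a clause of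
    their own, as they are not sums of e e^*; no nontrivial ghost path survives
    multiplication by one. *)
Fixpoint ghost_bound n : set L := if n is m.+1 then
  [set x | (forall e, ghost_bound m (x ** fedge F e)) /\
           (forall v, ~ (emitted v !=set0) -> real_span (x ** V v))]
  else real_span.

Lemma ghost_bound_submodule n : is_submodule (ghost_bound n).
Proof.
have [r0 rD rZ] := real_span_submodule.
elim: n => [|n [n0 nD nZ]]; first exact: real_span_submodule.
split=> /= [|x y [x1 x2] [y1 y2]|k x [x1 x2]]; split=> [e|v nv].
- by rewrite numul0l.
- by rewrite numul0l.
- by rewrite numulDl; exact: nD.
- by rewrite numulDl; apply: rD; [exact: x2|exact: y2].
- by rewrite -nuscalerAl; exact: nZ.
- by rewrite -nuscalerAl; apply: rZ; exact: x2.
Qed.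

Lemma ghost_boundS n x : ghost_bound n x -> ghost_bound n.+1 x.
Proof.
elim: n x => [|n IH] x /= hx.
  by split=> [e|v _]; [exact: real_span_edge|exact: real_span_vert].
by case: hx => x1 x2; split=> // e; exact: IH.
Qed.

Lemma ghost_boundW n m x : (n <= m)%N -> ghost_bound n x -> ghost_bound m x.
Proof.
move=> /subnK <-; elim: (m - n)%N => // k IH /IH.
exact: ghost_boundS.
Qed.

Lemma ghost_bound_mull a : (forall x, real_span x -> real_span (a ** x)) ->
  forall n x, ghost_bound n x -> ghost_bound n (a ** x).
Proof.
move=> ra; elim=> [|n IH] x; first exact: ra.
move=> /= [x1 x2]; split=> [e|v nv]; rewrite -numulA; first exact: IH.
by apply: ra; exact: x2.
Qed.

Lemma real_span_vertl v x : real_span x -> real_span (V v ** x).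
Proof.
apply: real_span_mull real_span_submodule _ _ => w p.
rewrite vert_real; case: ifP => _; first exact: real_span_path.
by case: real_span_submodule.
Qed.

Lemma real_span_edgel e x : real_span x -> real_span (fedge F e ** x).
Proof.
apply: real_span_mull real_span_submodule _ _ => w p.
rewrite edge_real; case: ifP => _; first exact: real_span_path.
by case: real_span_submodule.
Qed.

Lemma ghost_bound_star e : ghost_bound 1 (fstar F e).
Proof.
have [r0 _ _] := real_span_submodule.
split=> [f|v nv].
  by rewrite (lf_ck1 lf); case: eqP => // _; exact: (real_span_path _ [::]).
by rewrite star_vert; case: eqP => // ev; case: nv; exists e.
Qed.

(** Left multiplication by e^* is the one operation that raises the bound, for
    it may produce one ghost edge when it meets a vertex. *)
Lemma ghost_bound_starl e n x :
  ghost_bound n x -> ghost_bound n.+1 (fstar F e ** x).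
Proof.
have [r0 _ _] := real_span_submodule.
have base y : real_span y -> ghost_bound 1 (fstar F e ** y).
  apply: real_span_mull (ghost_bound_submodule 1) _ _ => v [|f p].
    rewrite star_vert; case: ifP => _; first exact: ghost_bound_star.
    by case: (ghost_bound_submodule 1).
  rewrite star_real; apply: ghost_boundS; case: ifP => // _.
  exact: real_span_path.
elim: n x => [|n IH] x; first exact: base.
move=> [x1 x2]; split=> [f|v nv]; rewrite -numulA; first exact/IH/x1.
have [_ /(_ v nv)] := base _ (x2 v nv).
by rewrite -!numulA (lf_idem lf).
Qed.

End LeavittFamily.

(** * Reduction of a nonzero element to a multiple of a vertex *)

Section Reduction.
Variables (R : comNzRingType) (E : graph) (hE : row_finite E).
Variables (L : nuAlgType R) (F : generators E L).
Hypothesis hL : leavitt_path_algebra F.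
Implicit Types (v w : vertex E) (e f : edge E) (p q : seq (edge E)) (x y : L).
Local Notation V := (fvert F).
Local Notation P := (real_path F).
Let lf := lpa_family hL.

(** Bounds on two factors give no bound on their product by themselves, so one
    proves together with the bound that left multiplication by the element
    raises all bounds by at most a constant. *)
Lemma ghost_bounded x : exists n, ghost_bound F n x.
Proof.
pose T := [set a | (exists n, ghost_bound F n a) /\
  exists m, forall n x, ghost_bound F n x -> ghost_bound F (m + n) (a ** x)].
suff TT : T = setT by have [] : T x by rewrite TT.
have sub n := ghost_bound_submodule F n.
have gen a m : (exists n, ghost_bound F n a) ->
    (forall n y, ghost_bound F n y -> ghost_bound F (m + n) (a ** y)) -> T a.
  by move=> ha hm; split=> //; exists m.
apply: (lpa_generated hL) => [|v|e|e].
- have TD a b : T a -> T b -> T (a + b).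
    move=> [[n an] [m hm]] [[n' bn] [m' hm']]; split.
      exists (maxn n n'); have [_ D _] := sub (maxn n n').
      apply: D; first exact: ghost_boundW (leq_maxl _ _) an.
      exact: ghost_boundW (leq_maxr _ _) bn.
    exists (maxn m m') => k y yk; have [_ D _] := sub (maxn m m' + k)%N.
    rewrite numulDl; apply: D.
      by apply: ghost_boundW (hm _ _ yk) => //; rewrite leq_add2r leq_maxl.
    by apply: ghost_boundW (hm' _ _ yk) => //; rewrite leq_add2r leq_maxr.
  have TZ k a : T a -> T (k *: a).
    move=> [[n an] [m hm]]; split.
      by exists n; have [_ _ Z] := sub n; exact: Z.
    exists m => l y yl; have [_ _ Z] := sub (m + l)%N.
    by rewrite -nuscalerAl; apply: Z; exact: hm.
  split=> [|a b Ta Tb|k a|a b [_ [m hm]] [[n bn] [m' hm']]].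
  + split; first by exists 0; have [] := sub 0.
    by exists 0%N => n y _; rewrite numul0l; have [] := sub (0 + n)%N.
  + by rewrite -scaleN1r; apply: TD => //; exact: TZ.
  + exact: TZ.
  + split; first by exists (m + n)%N; exact: hm.
    exists (m + m')%N => k y yk; rewrite -numulA -addnA.
    by apply: hm; exact: hm'.
- apply: (gen _ 0%N); first by exists 0%N; exact: (real_span_path _ _ [::]).
  by move=> n y; apply: ghost_bound_mull => z; exact: real_span_vertl.
- apply: (gen _ 0%N).
    exists 0%N; rewrite -[fedge F e](lf_srce lf) -(lf_rnge lf e).
    exact: (real_span_path F (src e) [:: e]).
  by move=> n y; apply: ghost_bound_mull => z; exact: real_span_edgel.
- apply: (gen _ 1%N); first by exists 1%N; exact: ghost_bound_star.
  by move=> n y; exact: ghost_bound_starl.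
Qed.

(** Stated in the proof for all large enough finite sets of vertices, so that
    two elements have a common local unit. *)
Lemma local_unit x : exists s : seq (vertex E), x ** (\sum_(v <- s) V v) = x.
Proof.
pose T := [set a : L | exists s0 : seq (vertex E), forall s, uniq s ->
  {subset s0 <= s} -> a ** (\sum_(v <- s) V v) = a].
have TV a v : a ** V v = a -> T a.
  move=> av; exists [:: v] => s us /(_ v); rewrite inE eqxx => /(_ isT) vs.
  rewrite -{1}av -numulA (bigD1_seq v)//= numulDr (lf_idem lf) numul_sumr.
  rewrite big1 ?addr0// => w wv; apply: (lf_orth lf) => vw.
  by rewrite vw eqxx in wv.
suff TT : T = setT.
  have [s hs] : T x by rewrite TT.
  exists (undup s); apply: hs; first exact: undup_uniq.
  by move=> v; rewrite mem_undup.
apply: (lpa_generated hL) => [|v|e|e].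
- split=> [|a b [s hs] [t ht]|k a [s hs]|a b _ [s hs]].
  + by exists [::] => s _ _; rewrite numul0l.
  + exists (s ++ t) => u uu stu; rewrite numulBl hs ?ht// => v vs; apply: stu.
      by rewrite mem_cat vs orbT.
    by rewrite mem_cat vs.
  + by exists s => u uu su; rewrite -nuscalerAl hs.
  + by exists s => u uu su; rewrite -numulA hs.
- exact/TV/lf_idem.
- exact/TV/lf_rnge.
- exact/TV/lf_srcs.
Qed.

Lemma neq0_vert x : x <> 0 -> exists v, x ** V v <> 0.
Proof.
move=> x0; apply: contrapT => nv; apply: x0.
have [s <-] := local_unit x; rewrite numul_sumr big1// => v _.
by apply: contrapT => xv; apply: nv; exists v.
Qed.

(** If x V v is nonzero and v emits edges, then V v is the sum of the e e^*,
    so x e is nonzero for one of them, with a smaller bound. *)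
Lemma reduction_to_real x : x <> 0 ->
  exists b, x ** b <> 0 /\ real_span F (x ** b).
Proof.
have [n] := ghost_bounded x; elim: n x => [|n IH] x xn x0.
  have [v xv] := neq0_vert x0; exists (V v); split=> //.
  exact: real_span_vert.
have [v xv] := neq0_vert x0; case: xn => x1 x2.
case: (pselect (emitted v !=set0)) => [ev|nv]; last first.
  by exists (V v); split=> //; exact: x2.
have [e xe] : exists e, x ** fedge F e <> 0.
  apply: contrapT => ne; apply: xv.
  have rv : regular v by split=> //; exact: hE.
  rewrite (lf_ck2 lf rv) fsbig_finite/=; last exact: hE.
  rewrite numul_sumr big1// => e _; rewrite numulA.
  suff -> : x ** fedge F e = 0 by rewrite numul0l.
  by apply: contrapT => xe; apply: ne; exists e.
have [b [xb rb]] := IH _ (x1 e) xe.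
by exists (fedge F e ** b); rewrite numulA.
Qed.

(** Once the paths are distinct, multiplying by p^* for a shortest path p turns
    p alone into a vertex, so that its coefficient cannot cancel. *)
Lemma real_span_normal x : real_span F x ->
  exists (s : seq (vertex E * seq (edge E))) (c : _ -> R),
  [/\ uniq s, forall t, t \in s -> c t <> 0 /\ is_path_from t.1 t.2
    & x = \sum_(t <- s) c t *: P t.1 t.2].
Proof.
case=> l ->.
pose s0 := undup [seq t.2 | t <- l].
pose c t := \sum_(u <- l | u.2 == t) u.1.
pose good t := (c t != 0) && is_path_from t.1 t.2.
exists [seq t <- s0 | good t], c; split.
- by rewrite filter_uniq ?undup_uniq.
- by move=> t; rewrite mem_filter => /andP[/andP[/eqP ct ht] _].
rewrite big_filter; transitivity (\sum_(t <- s0) c t *: P t.1 t.2).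
  under [RHS]eq_bigr do rewrite /c scaler_suml.
  rewrite (exchange_big_dep predT)//= big_seq [RHS]big_seq.
  apply: eq_bigr => u ul; rewrite big_mkcond (bigD1_seq u.2) ?undup_uniq//=.
    rewrite eqxx big1 ?addr0// => t; rewrite eq_sym.
    by case: (u.2 == t).
  by rewrite mem_undup map_f.
rewrite [RHS]big_mkcond; apply: eq_bigr => t _ /=.
case: ifPn => //; rewrite negb_and negbK => /orP[/eqP->|/(real_invalid lf)->].
  exact: scale0r.
exact: scaler0.
Qed.

Lemma ex_minimum_seq (T : eqType) (s : seq T) (m : T -> nat) : s != [::] ->
  exists2 t, t \in s & forall u, u \in s -> (m t <= m u)%N.
Proof.
elim: s => // t [|u s] IH _; first by exists t; rewrite ?inE// => u /[!inE]/eqP->.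
have [//|z zs hz] := IH.
case: (leqP (m z) (m t)) => zt.
  exists z; first by rewrite inE zs orbT.
  by move=> y; rewrite inE => /orP[/eqP->//|]; exact: hz.
exists t; first by rewrite inE eqxx.
move=> y; rewrite inE => /orP[/eqP->//|/hz]; exact/leq_trans/ltnW.
Qed.

(** The multipliers are g^* p^* on the left and g on the right, with p a
    shortest path and g chosen to kill the positive-length remainders of the
    other paths. *)
Lemma reduction x : condition_L E -> x <> 0 ->
  exists a b k v, k <> 0 /\ a ** x ** b = k *: V v.
Proof.
move=> cL /reduction_to_real [b0 [y0 /real_span_normal [s [c [us cs yE]]]]].
have sn : s != [::].
  by apply/eqP => s0; apply: y0; rewrite yE s0 big_nil.
have [t ts tmin] := ex_minimum_seq (fun t => size t.2) sn.
have [ct vt] := cs t ts.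
pose n := size t.2; pose r := path_end t.1 t.2.
have [g [vg gQ]] := avoid_closed_paths r [seq drop n u.2 | u <- s] cL.
exists (ghost_path F r g ** ghost_path F t.1 t.2), (b0 ** P r g), (c t), (path_end r g).
split=> //; rewrite -numulA [x ** _]numulA yE.
rewrite numul_suml numul_sumr (bigD1_seq t)//= -[RHS]addr0; congr (_ + _).
  rewrite -nuscalerAl -nuscalerAr; congr (_ *: _).
  rewrite -numulA [X in _ ** X]numulA ghost_real// eqxx prefix_refl drop_size.
  rewrite vert_real// eqxx ghost_real// eqxx prefix_refl.
  by rewrite drop_size.
(* The other paths: either p^* kills them, or a nonempty path q is left. *)
rewrite big_seq_cond big1// => u /andP[us' ut].
rewrite -nuscalerAl -nuscalerAr -numulA [X in _ ** X]numulA.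
rewrite ghost_real ?tmin//; case: ifP => [/andP[/eqP tu pu]|_]; last first.
  by rewrite numul0l numul0r scaler0.
rewrite -/n -/r; set q := drop n u.2.
have q0 : q != [::].
  apply: contra ut => /eqP q0; rewrite [u]surjective_pairing [t]surjective_pairing tu.
  by rewrite -(cat_take_drop n u.2) -/q q0 cats0; move: pu; rewrite prefixE => /eqP->.
(* A remainder that is not closed at r dies already in q g. *)
case: (boolP (closed_path r q)) => [rq|]; last first.
  rewrite /closed_path q0 /= negb_and => /orP[/(real_invalid lf)->|rq].
    by rewrite numul0l numul0r scaler0.
  by rewrite real_real// (negbTE rq) numul0r scaler0.
have [_ _ rqr] := and3P rq; rewrite real_real// rqr.
rewrite ghost_real ?size_cat ?leq_addl// eqxx /=.
have qs : q \in [seq drop n u.2 | u <- s] by rewrite (map_f (fun u => drop n u.2)).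
by rewrite (negbTE (gQ _ qs rq)) scaler0.
Qed.

(** * Sufficiency of the two conditions *)

(** Ideals are not assumed stable under scalars, while subalgebras are; the set
    of x all of whose multiples lie in I is a subalgebra, and contains the
    generators because k x = v (k x) when v x = x. *)
Lemma ideal_of_vertices_full I : two_sided_ideal I -> (forall v, I (V v)) -> I = setT.
Proof.
case=> I0 IB Il Ir IV.
have kx x v : V v ** x = x -> forall k, I (k *: x).
  by move=> vx k; rewrite -vx nuscalerAr; exact: Ir.
suff TT : [set x | forall k : R, I (k *: x)] = setT.
  apply/seteqP; split=> // x _; rewrite -[x]scale1r.
  by have : [set x | forall k : R, I (k *: x)] x by rewrite TT.
apply: (lpa_generated hL) => [|v|e|e].
- split=> [k|x y hx hy k|k x hx l|x y hx hy k] /=.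
  + by rewrite scaler0.
  + by rewrite scalerBr; exact: IB.
  + by rewrite scalerA.
  + by rewrite nuscalerAl; exact: Ir.
- exact/kx/lf_idem.
- exact/kx/lf_srce.
- exact/kx/lf_rngs.
Qed.

Lemma ideal_add (I : set L) x y : two_sided_ideal I -> I x -> I y -> I (x + y).
Proof.
move=> hI Ix Iy; rewrite -[y]opprK; apply: (idealB hI) => //.
by rewrite -sub0r; apply: (idealB hI) => //; exact: (ideal0 hI).
Qed.

Lemma basically_simple_of_conditions :
  (forall H : set (vertex E), hereditary H -> saturated H ->
     H = set0 \/ H = setT) -> condition_L E -> basically_simple F.
Proof.
move=> hs cL I hI bI.
case: (pselect (exists2 x, I x & x <> 0)) => [[x Ix x0]|nx]; [right|left];
    last first.
  apply/seteqP; split=> [x Ix|x ->]; last exact: (ideal0 hI).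
  by apply: contrapT => x0; apply: nx; exists x.
have [a [b [k [v [k0 axb]]]]] := reduction cL x0.
have Iv : I (V v).
  apply: (bI k); first exact/eqP.
  by rewrite -axb; apply: (Defs.idealMr hI); exact: (idealMl hI).
pose H := [set w | I (V w)].
have hH : hereditary H.
  move=> e; rewrite /H /= => Ie.
  have := lf_ck1 lf e e; rewrite eqxx => <-.
  rewrite -(lf_srce lf e); apply: (idealMl hI).
  exact: (Defs.idealMr hI).
have sH : saturated H.
  move=> w rw rH; rewrite /H /= (lf_ck2 lf rw).
  rewrite fsbig_finite/=; last by case: rw.
  rewrite big_seq; apply: big_ind => [|y z|e]; first exact: (ideal0 hI).
    exact: ideal_add.
  rewrite in_fset_set; last exact: hE.
  move=> /set_mem we; rewrite -(lf_rnge lf e) -numulA.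
  apply: (idealMl hI); apply: (Defs.idealMr hI).
  by apply: rH; exists e.
apply: ideal_of_vertices_full => // w.
have [H0|HT] := hs H hH sH.
  by have : H v by []; rewrite H0.
by have : H w by rewrite HT.
Qed.

End Reduction.

Theorem theorem7p20 (R : comNzRingType) (E : graph) (hE : row_finite E)
    (L : nuAlgType R) (F : generators E L) (hL : leavitt_path_algebra F) :
  basically_simple F <->
  (forall H : set (vertex E), hereditary H -> saturated H ->
     H = set0 \/ H = setT) /\
  condition_L E.
Proof.
split=> [simp|[hs cL]]; last exact: (basically_simple_of_conditions hE hL).
split; first exact: (basically_simple_saturated hE hL simp).
exact: (basically_simple_condition_L hE hL simp).
Qed.
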